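(* Let $G=(V,E)$ be a finite graph and let $A,B\subseteq V$ be two vertex subsets of $G$. Let $$\Delta(G,A,B)=\sigma(G_{-A})\cdot\sigma(G_{-B})-\sigma(G)\cdot\sigma(G_{-A-B}).$$ Then $$\Delta(G,A,B)\ \begin{cases}<0 & \text{if } P(G,A,B)\text{ is even},\\ =0 & \text{if } P(G,A,B)\text{ is infinite},\\ >0 & \text{if } P(G,A,B)\text{ is odd}.\end{cases}$$
   Context: Graphs are finite and simple (undirected, no loops or multiple edges). $\sigma(G)$ denotes the number of independent vertex sets of $G$, i.e. the number of subsets $W\subseteq V$ (including $W=\emptyset$) such that no two vertices of $W$ are adjacent; the empty graph (no vertices) has $\sigma=1$. For $W\subseteq V$, $G_{-W}$ is the graph obtained from $G$ by removing all vertices of $W$ and their incident edges; $G_{-A-B}=G_{-(A\cup B)}$. The sets $A,B$ are not assumed disjoint. A path $P=(v_1,\ldots,v_k)$ of $G$ ($k\ge 1$, distinct vertices, consecutive ones adjacent) with vertex set $V(P)$ is an $A$-$B$-path if $V(P)\cap A=\{v_1\}$ and $V(P)\cap B=\{v_k\}$. Its length is its number of edges, $|V(P)|-1$; in particular a single vertex of $A\cap B$ is an $A$-$B$-path of length $0$. $P(G,A,B)$ denotes the set of all $A$-$B$-paths in $G$. One says that $P(G,A,B)$ is infinite if there is no $A$-$B$-path in $G$; that $P(G,A,B)$ is even if there is at least one $A$-$B$-path and every $A$-$B$-path has even length; and that $P(G,A,B)$ is odd if there is at least one $A$-$B$-path and every $A$-$B$-path has odd length. *)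

(* Defs.v *)
From mathcomp Require Import all_boot all_order all_algebra.

Set Implicit Arguments.
Unset Strict Implicit.
Unset Printing Implicit Defensive.

Record sgraph := SGraph {
  vertex :> finType;
  adj : rel vertex;
  adj_sym : symmetric adj;
  adj_irr : irreflexive adj }.

Section Graph.
Variable G : sgraph.

Definition independent (W : {set G}) : bool :=
  [forall x in W, forall y in W, ~~ adj x y].

Definition sigma : nat := #|[set W : {set G} | independent W]|.

Section Remove.
Variable W : {set G}.

Definition remove_adj : rel {x : G | x \notin W} :=
  fun x y => adj (val x) (val y).

Fact remove_adj_sym : symmetric remove_adj.
Proof. by move=> x y; apply: adj_sym. Qed.

Fact remove_adj_irr : irreflexive remove_adj.
Proof. by move=> x; apply: adj_irr. Qed.

Definition remove : sgraph := SGraph remove_adj_sym remove_adj_irr.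
End Remove.

(* A path (v_1, ..., v_k) is the nonempty sequence of its vertices. *)
Definition AB_paths (A B : {set G}) : {pred seq G} := fun s =>
  if s is x :: p then
    [&& path (@adj G) x p, uniq (x :: p),
        [set:: x :: p] :&: A == [set x] &
        [set:: x :: p] :&: B == [set last x p]]
  else false.

Definition path_length (s : seq G) : nat := (size s).-1.

Definition P_infinite (A B : {set G}) : Prop :=
  ~ (exists s, s \in AB_paths A B).

Definition P_even (A B : {set G}) : Prop :=
  (exists s, s \in AB_paths A B) /\
  (forall s, s \in AB_paths A B -> ~~ odd (path_length s)).

Definition P_odd (A B : {set G}) : Prop :=
  (exists s, s \in AB_paths A B) /\
  (forall s, s \in AB_paths A B -> odd (path_length s)).

End Graph.

(* Computed in int because subtraction on nat is truncated. *)
Definition Delta (G : sgraph) (A B : {set G}) : int :=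
  ((sigma (remove A))%:Z * (sigma (remove B))%:Z
   - (sigma G)%:Z * (sigma (remove (A :|: B)))%:Z)%R.

(* Main.v *)
Require Import Defs.
From mathcomp Require Import all_boot all_order all_algebra.
From mathcomp Require Import zify.

(** The proof compares two families of pairs $(I,J)$ of independent sets.  The
product $\sigma(G_{-A})\sigma(G_{-B})$ counts the pairs with $I\cap A=\emptyset$
and $J\cap B=\emptyset$, and $\sigma(G)\sigma(G_{-A-B})$ those where $J$ avoids
$A\cup B$.  The subgraph induced on the symmetric difference $D$ of $I$ and $J$
is bipartite, with sides $I\setminus J$ and $J\setminus I$, and exchanging $I$
and $J$ on a union of its components yields again two independent sets.

Exchange them on the components that meet $A$ ([flip]).  This does not
change $D$, so it is an involution.  Call a pair linked when some component of
$D$ meets both $A$ and $B$.  On unlinked pairs the flip leaves $B$ alone and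
moves the condition on $A$ from one member of the pair to the other, so both
families have the same number of unlinked pairs, and $\Delta$ is the difference
of the numbers of linked pairs ([Delta_linked]).

In a linked pair the vertices of $A\cap D$ and of $B\cap D$ lie on opposite
sides of $D$ in the first family, on the same side in the second, so a path of
$D$ between them has odd, respectively even, length ([linked_AB_path]).
Conversely a shortest $A$-$B$-path is chordless, so its two alternating classes
of vertices are independent, and they form a linked pair whose family is given
by the parity of the path ([AB_path_linked]).  Hence, of the two numbers of
linked pairs, both vanish if there is no $A$-$B$-path, and exactly one vanishes
if there are such paths and all have the same parity. *)

Set Implicit Arguments.
Unset Strict Implicit.
Unset Printing Implicit Defensive.

(** * Walks and shortest walks *)

Section Walks.
Variable G : sgraph.
Implicit Types (A B D : {set G}) (x y : G) (s : seq G).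

(** Vertices may repeat and interior vertices may lie in $A$ or $B$, so that
walks can be cut and concatenated freely; minimality of the length restores
the conditions on $A$-$B$-paths.  Confining the walk to $D$ serves to speak of
the components of the subgraph induced on $D$. *)
Definition walk D A B : pred (seq G) := fun s =>
  if s is x :: p then
    [&& path (@adj G) x p, all [in D] s, x \in A & last x p \in B]
  else false.

Lemma walk_split D A B s1 x s2 :
  walk D A B (s1 ++ x :: s2) =
  walk D A [set x] (rcons s1 x) && walk D [set x] B (x :: s2).
Proof.
case: s1 => [|y s1] /=.
  by rewrite inE eqxx; case: path; case: (x \in D); case: (x \in A); case: all.
rewrite cat_path last_cat last_rcons rcons_path all_cat all_rcons /= !inE eqxx.
by case: path; case: adj; case: path; case: (y \in D); case: (x \in D);
  case: (y \in A); case: all; case: all.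
Qed.

Lemma walk_cat D A B s1 s2 x y :
  walk D A [set x] s1 -> adj x y -> walk D [set y] B s2 ->
  walk D A B (s1 ++ s2).
Proof.
case: s1 => // u p /and4P[pathp allp uA /set1P last_p] adj_xy.
case: s2 => // v r /and4P[pathr allr /set1P v_y lastB].
apply/and4P; split; rewrite -?cat_cons ?cat_path ?all_cat ?last_cat //=.
- by rewrite pathp last_p v_y adj_xy -v_y.
- exact/andP.
Qed.

Definition shortest_walk D A B s :=
  walk D A B s /\ forall r, walk D A B r -> size s <= size r.

Lemma shortest_walk_exists D A B s :
  walk D A B s -> exists r, shortest_walk D A B r.
Proof.
move=> walk_s; pose P n := [exists t : n.-tuple G, walk D A B t].
have walkP r : walk D A B r -> P (size r).
  by move=> wr; apply/existsP; exists (in_tuple r).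
have [n /existsP[t walk_t] min_n] := ex_minnP (ex_intro P _ (walkP s walk_s)).
by exists t; split=> // r /walkP/min_n; rewrite size_tuple.
Qed.

(** Each property of a shortest walk below comes from cutting a piece out of it:
the part between the ends of a chord or between two occurrences of a vertex,
the part before a vertex of $A$, or the part after a vertex of $B$. *)
Section Shortest.
Variables (D A B : {set G}) (s : seq G).
Hypothesis s_shortest : shortest_walk D A B s.

Let s_walk : walk D A B s. Proof. by case: s_shortest. Qed.

Let split_walk x0 i : i < size s ->
  walk D A [set nth x0 s i] (take i.+1 s) &&
  walk D [set nth x0 s i] B (drop i s).
Proof.
move=> lti; rewrite (take_nth x0) // (drop_nth x0) // -walk_split.
by rewrite -drop_nth // cat_take_drop.
Qed.

Lemma shortest_walk_chordless x0 i j : i < size s -> j < size s ->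
  adj (nth x0 s i) (nth x0 s j) -> j <= i.+1.
Proof.
move=> lti ltj adj_ij; have /andP[pre _] := split_walk x0 lti.
have /andP[_ post] := split_walk x0 ltj.
have := s_shortest.2 _ (walk_cat pre adj_ij post).
rewrite size_cat size_drop size_takel //; lia.
Qed.

Lemma shortest_walk_uniq : uniq s.
Proof.
case Ds: s => [//|x0 p]; rewrite -Ds.
suff le i j : i < size s -> j < size s -> nth x0 s i = nth x0 s j -> j <= i.
  apply/(uniqP x0) => i j lti ltj eqij.
  by apply/eqP; rewrite eqn_leq; apply/andP; split; apply: le.
move=> lti ltj eqij; have /andP[pre _] := split_walk x0 lti.
have /andP[_ post] := split_walk x0 ltj.
rewrite (take_nth x0) // eqij in pre; rewrite (drop_nth x0) // in post.
have := s_shortest.2 (take i s ++ nth x0 s j :: drop j.+1 s).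
rewrite walk_split pre post => /(_ isT).
rewrite -drop_nth // size_cat size_drop (size_takel (ltnW lti)); lia.
Qed.

Lemma shortest_walk_start x : x \in s -> x \in A -> x = head x s.
Proof.
move=> x_s xA; have lti : index x s < size s by rewrite index_mem.
have /andP[_] := split_walk x lti; rewrite (drop_nth x) // nth_index //.
move=> post; have /s_shortest.2: walk D A B (x :: drop (index x s).+1 s).
  by move: post => /= /and4P[-> -> _ ->]; rewrite xA.
move=> /= le; have idx0 : index x s = 0 by move: le; rewrite size_drop; lia.
by rewrite -nth0 -idx0 nth_index.
Qed.

Lemma shortest_walk_end x : x \in s -> x \in B -> x = last x s.
Proof.
move=> x_s xB; have lti : index x s < size s by rewrite index_mem.
have /andP[+ _] := split_walk x lti; rewrite (take_nth x) // nth_index //.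
move=> pre; have /s_shortest.2: walk D A B (rcons (take (index x s) s) x).
  move: pre; case: (take _ s) => [|u p] /=.
    by case/and3P=> -> -> _; rewrite xB.
  by case/and4P=> -> -> -> _; rewrite last_rcons.
rewrite size_rcons (size_takel (ltnW lti)) => le.
have idx : index x s = (size s).-1 by lia.
by rewrite -nth_last -idx nth_index.
Qed.

Lemma shortest_walk_AB_path : s \in AB_paths A B.
Proof.
have:= shortest_walk_start; have:= shortest_walk_end; move: shortest_walk_uniq.
move: s_walk; rewrite unfold_in; case: s => // x p /and4P[xp _ xA lB] uq eB eA.
apply/and4P; split=> //; apply/eqP/setP=> y; rewrite !inE.
  by apply/andP/eqP=> [[/eA yA /yA]|->] //; rewrite eqxx.
apply/andP/eqP=> [[/eB yB /yB]|->] //; split=> //.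
by rewrite -in_cons mem_last.
Qed.

End Shortest.

Lemma AB_path_walk A B s : s \in AB_paths A B -> walk setT A B s.
Proof.
case: s => // x p /and4P[xp _ /eqP sA /eqP sB]; rewrite /= xp /=.
have /setIP[_ ->] : x \in [set:: x :: p] :&: A by rewrite sA set11.
have /setIP[_ ->] : last x p \in [set:: x :: p] :&: B by rewrite sB set11.
by rewrite in_setT !andbT; apply/allP=> y; rewrite in_setT.
Qed.

(** * Components of an induced subgraph *)

Definition induced_adj D : rel G :=
  [rel x y | [&& x \in D, y \in D & adj x y]].

(** The union of the components of the subgraph induced on $D$ that meet $A$. *)
Definition reach D A : {set G} :=
  [set x | [exists a in A :&: D, connect (induced_adj D) a x]].

Lemma reachP D A x :
  reflect (exists s, walk D A [set x] s) (x \in reach D A).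
Proof.
rewrite inE; apply: (iffP exists_inP) => [[a /setIP[aA aD]] | [[|a p] //=]].
  case/connectP=> p ap ->; exists (a :: p); apply/and4P; split=> //.
  - by apply: sub_path ap => b c /and3P[].
  - rewrite /= aD; elim: p a {aA aD} ap => //= b p IHp a /andP[/and3P[_ bD _]].
    by move/IHp=> ->; rewrite bD.
  - exact: set11.
case/and4P=> ap /andP[aD pD] aA /set1P<-; exists a; first exact/setIP.
apply/connectP; exists p => //; elim: p a ap aD pD {aA} => //= b p IHp a.
by case/andP=> ab bp aD /andP[bD pD]; rewrite IHp // andbT; apply/and3P.
Qed.

Lemma reach_sub D A x : x \in reach D A -> x \in D.
Proof.
case/reachP=> [[//|a p]] /and4P[_ /allP sD _ /set1P <-].
by apply: (sD); rewrite mem_last.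
Qed.

Lemma sub_reach D A x : x \in A -> x \in D -> x \in reach D A.
Proof. by move=> xA xD; apply/reachP; exists [:: x]; rewrite /= xD xA set11. Qed.

Lemma reach_adj D A x y :
  x \in reach D A -> adj x y -> y \in D -> y \in reach D A.
Proof.
case/reachP=> s ws xy yD; apply/reachP; exists (s ++ [:: y]).
by apply: walk_cat ws xy _; rewrite /= yD set11.
Qed.

Lemma reach_meetsP D A B :
  reflect (exists s, walk D A B s) (~~ [disjoint reach D A & B]).
Proof.
apply: (iffP pred0Pn) => [[b /andP[/reachP[s ws] bB]] | [s ws]].
  exists s; case: s ws => //= x p /and4P[-> -> -> /set1P-> /=]; exact: bB.
case: s ws => // x p /and4P[xp pD xA lB]; exists (last x p); apply/andP.
split=> //; apply/reachP; exists (x :: p); apply/and4P.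
by split=> //; apply: set11.
Qed.

End Walks.

(** * Pairs of independent sets *)

Lemma independentP (G : sgraph) (I : {set G}) :
  reflect {in I &, forall x y, ~~ adj x y} (independent I).
Proof.
apply: (iffP forall_inP) => [indI x y xI yI | indI x xI].
  by have /forall_inP := indI x xI; apply.
by apply/forall_inP=> y; apply: indI.
Qed.

Section Pairs.
Variable G : sgraph.
Implicit Types (A B D I J K W : {set G}) (x y : G) (q : {set G} * {set G}).

Definition avoiding W : {set {set G}} :=
  [set I | independent I && [disjoint I & W]].

Lemma sigma_remove W : sigma (remove W) = #|avoiding W|.
Proof.
rewrite /sigma -(card_imset _ (imset_inj val_inj)).
apply: eq_card => I; rewrite inE; apply/imsetP/andP=> [[U] | [indI dIW]].
  rewrite inE => /independentP indU ->; split.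
    by apply/independentP=> _ _ /imsetP[x xU ->] /imsetP[y yU ->]; apply: indU.
  by apply/pred0P=> y /=; apply/andP=> [[/imsetP[x _ ->]]]; apply/negP/(valP x).
exists (val @^-1: I).
  rewrite inE; apply/independentP=> x y; rewrite !inE.
  by move/independentP: indI; apply.
apply/setP=> x; apply/idP/imsetP=> [xI | [u + ->]]; last by rewrite inE.
have xW : x \notin W by rewrite (disjointFr dIW).
by exists (Sub x xW); rewrite ?inE /=.
Qed.

Lemma sigma_avoiding : sigma G = #|avoiding set0|.
Proof. by apply: eq_card => I; rewrite !inE -setI_eq0 setI0 eqxx andbT. Qed.

(** The two families at once: the boolean is the parity of the $A$-$B$-paths
that the linked pairs of the family produce. *)
Definition pairs A B (t : bool) : {set {set G} * {set G}} :=
  [set q | [&& independent q.1, independent q.2, [disjoint q.2 & B]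
             & [disjoint (if t then q.1 else q.2) & A]]].

Lemma card_pairs A B t : #|pairs A B t| =
  if t then #|avoiding A| * #|avoiding B|
  else #|avoiding set0| * #|avoiding (A :|: B)|.
Proof.
case: t; rewrite -cardsX; apply: eq_card => -[I J]; rewrite !inE /=.
  by case: independent; case: independent; rewrite ?andbF //= andbC.
by rewrite -!setI_eq0 setI0 setIUr setU_eq0 eqxx andbT [(_ == _) && _]andbC.
Qed.

Definition support q : {set G} := [set x | (x \in q.1) (+) (x \in q.2)].

Definition linked A B q : bool := ~~ [disjoint reach (support q) A & B].

Definition swap_on K q : {set G} * {set G} :=
  ([set x | x \in if x \in K then q.2 else q.1],
   [set x | x \in if x \in K then q.1 else q.2]).

Definition flip A q := swap_on (reach (support q) A) q.

Lemma support_swap_on K q : support (swap_on K q) = support q.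
Proof. by apply/setP=> x; rewrite !inE; case: ifP => _ //; rewrite addbC. Qed.

Lemma swap_onK K : involutive (swap_on K).
Proof.
by case=> I J; congr (_, _); apply/setP=> x; rewrite inE /=;
  case: ifP => xK; rewrite inE xK.
Qed.

Lemma flipK A : involutive (flip A).
Proof. by move=> q; rewrite {1}/flip support_swap_on swap_onK. Qed.

(** An edge of the new set between $K$ and its complement would join a vertex of
$J$ in $K$ to a vertex of $I$ outside $K$.  As $K$ is closed under adjacency
into the symmetric difference of $I$ and $J$, the latter vertex lies in both
sets, and $J$ would contain an edge. *)
Lemma independent_swap K I J : independent I -> independent J ->
  (forall x y, x \in K -> adj x y -> (y \in I) (+) (y \in J) -> y \in K) ->
  independent [set x | x \in if x \in K then J else I].
Proof.
move=> /independentP indI /independentP indJ clK.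
have cross x y : x \in K -> y \notin K -> x \in J -> y \in I -> ~~ adj x y.
  move=> xK yK xJ yI; apply/negP=> xy.
  have /contraNN/(_ yK) := clK _ _ xK xy; rewrite yI addTb negbK => yJ.
  by have := indJ _ _ xJ yJ; rewrite xy.
apply/independentP=> x y; rewrite !inE.
case: ifPn => xK; case: ifPn => yK; [exact: indJ | exact: cross | | exact: indI].
by move=> xI yJ; rewrite adj_sym cross.
Qed.

(** A vertex of $A$ that belongs to one of the two sets belongs to one only, so
it is in the support and the flip moves it to the other set; the pair being
unlinked, the flip moves no vertex of $B$. *)
Lemma flip_pairs A B t q : q \in pairs A B t -> ~~ linked A B q ->
  flip A q \in pairs A B (~~ t).
Proof.
case: q => I J; rewrite inE negbK /= => /and4P[indI indJ dJB dA] unl.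
have clK x y : x \in reach (support (I, J)) A -> adj x y ->
    (y \in I) (+) (y \in J) -> y \in reach (support (I, J)) A.
  by move=> xK xy yD; apply: reach_adj xK xy _; rewrite inE.
have AK x : x \in A -> x \notin reach (support (I, J)) A ->
    (x \in I) = (x \in J).
  by move=> xA; apply: contraNeq; rewrite negb_eqb => xD; rewrite sub_reach ?inE.
rewrite inE; apply/and4P; split.
- exact: independent_swap.
- apply: independent_swap => // x y xK xy; rewrite addbC; exact: clK xK xy.
- apply/pred0P=> x /=; apply/andP=> -[+ xB].
  by rewrite inE (disjointFl unl xB) (disjointFl dJB xB).
apply/pred0P=> x /=; apply/andP=> -[+ xA]; move: (AK x xA) (disjointFl dA xA).
by case: (t); rewrite /= inE; case: (_ \in reach _ _) => [_ ->|/(_ isT) -> ->].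
Qed.

Lemma linked_flip A B q : linked A B (flip A q) = linked A B q.
Proof. by rewrite /linked support_swap_on. Qed.

Definition linked_pairs A B t := pairs A B t :&: [set q | linked A B q].

(** The flip embeds the unlinked pairs of each family into those of the other. *)
Lemma card_unlinked A B t :
  #|pairs A B t :\: [set q | linked A B q]| =
  #|pairs A B (~~ t) :\: [set q | linked A B q]|.
Proof.
suff le u : #|pairs A B u :\: [set q | linked A B q]| <=
            #|pairs A B (~~ u) :\: [set q | linked A B q]|.
  by apply/eqP; rewrite eqn_leq le -{2}[t]negbK le.
rewrite -(card_imset _ (inv_inj (flipK A))); apply/subset_leq_card/subsetP.
move=> r /imsetP[q /setDP[qP]]; rewrite inE => unl ->.
by rewrite in_setD inE linked_flip unl flip_pairs.
Qed.

Lemma Delta_linked A B :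
  (Delta A B = #|linked_pairs A B true|%:Z - #|linked_pairs A B false|%:Z)%R.
Proof.
rewrite /Delta !sigma_remove sigma_avoiding -!PoszM.
rewrite -(card_pairs A B true) -(card_pairs A B false).
rewrite -(cardsID [set q | linked A B q] (pairs A B true)).
rewrite -(cardsID [set q | linked A B q] (pairs A B false)) card_unlinked.
by rewrite !PoszD GRing.opprD GRing.addrACA GRing.subrr GRing.addr0.
Qed.

(** * Linked pairs and the parity of paths *)

(** Adjacent vertices of the support lie in different members of the pair. *)
Lemma walk_support_parity A B q x p : independent q.1 -> independent q.2 ->
  walk (support q) A B (x :: p) ->
  (last x p \in q.1) = (x \in q.1) (+) odd (size p).
Proof.
move=> /independentP indI /independentP indJ /= /and4P[+ + _ _].
elim: p x => [|y p IHp] x /=; first by rewrite addbF.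
case/andP=> xy yp /and3P[xD yD pD]; rewrite IHp ?yD // addbN -addNb.
congr (_ (+) _); have := indI x y; have := indJ x y; move: xD yD; rewrite !inE xy.
by do !case: (_ \in _) => //=;
  [move=> _ _ _ /(_ isT isT) | move=> _ _ /(_ isT isT)].
Qed.

(** A shortest walk of the support from $A$ to $B$ is the required path.  Its last
vertex is in the first member of the pair, as the second one avoids $B$; its
first vertex is in whichever member may meet $A$, which fixes the parity. *)
Lemma linked_AB_path A B t q : q \in linked_pairs A B t ->
  exists2 s, s \in AB_paths A B & odd (path_length s) = t.
Proof.
rewrite !inE => /andP[/and4P[indI indJ dJB dA] /reach_meetsP[r wr]].
have [s s_min] := shortest_walk_exists wr.
exists s; first exact: shortest_walk_AB_path s_min.
case: s_min; case: s => // x p w _; have := walk_support_parity indI indJ w.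
case/and4P: w => _ /allP pD xA lB; rewrite /path_length /=.
have:= pD x (mem_head _ _); have:= pD _ (mem_last x p); rewrite !inE.
rewrite (disjointFl dJB lB) addbF => ->.
by case: (t) dA => dA; rewrite (disjointFl dA xA) ?addbF ?addFb => // ->; case: odd.
Qed.

(** The alternating classes of a shortest $A$-$B$-path are independent because
the path is chordless.  The class of the end vertex must come first, since
the second member has to avoid $B$. *)
Lemma AB_path_linked A B t : (exists s, s \in AB_paths A B) ->
  (forall s, s \in AB_paths A B -> odd (path_length s) = t) ->
  exists q, q \in linked_pairs A B t.
Proof.
case=> r /AB_path_walk/shortest_walk_exists[s s_min] all_t.
have := all_t s (shortest_walk_AB_path s_min); rewrite /path_length => par.
pose cls c : {set G} := [set x in s | odd (index x s) == c].
have ind c : independent (cls c).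
  apply/independentP=> x y; rewrite !inE => /andP[xs /eqP xc] /andP[ys /eqP yc].
  apply/negP=> xy.
  have le u v : u \in s -> v \in s -> adj u v -> index v s <= (index u s).+1.
    move=> us vs uv; apply: (shortest_walk_chordless s_min (x0 := u));
    by rewrite ?index_mem ?nth_index.
  have := le _ _ xs ys xy; rewrite leq_eqVlt ltnS => /orP[/eqP e | yx].
    by move: yc; rewrite e /= xc; case: (c).
  have yx' : adj y x by rewrite adj_sym.
  have := le _ _ ys xs yx'; rewrite leq_eqVlt ltnS => /orP[/eqP e | xy'].
    by move: xc; rewrite e /= yc; case: (c).
  have /(congr1 (nth x s)) : index x s = index y s.
    by apply/eqP; rewrite eqn_leq yx xy'.
  by rewrite !nth_index // => eq_xy; move: xy; rewrite eq_xy adj_irr.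
have cls_addb c x : (x \in cls c) (+) (x \in cls (~~ c)) = (x \in s).
  by rewrite !inE; case: (_ \in s) => //=; case: odd; case: c.
exists (cls t, cls (~~ t)); rewrite !inE /= !ind /= -andbA; apply/and3P; split.
- apply/pred0P=> x /=; rewrite inE; apply/negP=> /andP[/andP[xs odd_x] xB].
  have := shortest_walk_end s_min xs xB; rewrite -nth_last => xE.
  move: odd_x; rewrite {1}xE index_uniq ?(shortest_walk_uniq s_min) //.
    by rewrite par; case: (t).
  by case: (s) xs => //= ? ? _; rewrite ltnS.
- have -> : (if t then cls t else cls (~~ t)) = cls true by case: (t).
  apply/pred0P=> x /=; rewrite inE; apply/negP=> /andP[/andP[xs odd_x] xA].
  move: odd_x; rewrite (shortest_walk_start s_min xs xA).
  by case: (s) xs => //= ? ? _; rewrite eqxx.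
apply/reach_meetsP; exists s; case: s_min => w _.
have -> : support (cls t, cls (~~ t)) = [set:: s].
  by apply/setP=> x; rewrite [LHS]in_set cls_addb inE.
case: (s) w => // x p /and4P[xp _ xA lB]; apply/and4P; split=> //.
by apply/allP=> y; rewrite inE.
Qed.

End Pairs.

Theorem theorem7 (G : sgraph) (A B : {set G}) :
  [/\ P_even A B -> (Delta A B < 0)%R,
      P_infinite A B -> Delta A B = 0%R
    & P_odd A B -> (0 < Delta A B)%R].
Proof.
have none t : (forall s, s \in AB_paths A B -> odd (path_length s) <> t) ->
    #|linked_pairs A B t| = 0.
  move=> no_t; apply/eqP; rewrite cards_eq0; apply/eqP/setP=> q; rewrite in_set0.
  by apply/negP=> /linked_AB_path[s /no_t].
have some t : (exists s, s \in AB_paths A B) ->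
    (forall s, s \in AB_paths A B -> odd (path_length s) = t) ->
    0 < #|linked_pairs A B t|.
  by move=> ex all_t; apply/card_gt0P; apply: AB_path_linked.
rewrite Delta_linked; split=> [[ex even_len] | inf | [ex odd_len]].
- have L0 : #|linked_pairs A B true| = 0 by apply: none => s /even_len/negP.
  have R1 : 0 < #|linked_pairs A B false|.
    by apply: some => // s /even_len/negbTE.
  by lia.
- by rewrite !none // => s ps; case: inf; exists s.
have R0 : #|linked_pairs A B false| = 0 by apply: none => s /odd_len->.
have L1 : 0 < #|linked_pairs A B true| by apply: some.
by lia.
Qed.
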